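(* Assume $\omega_a\ne0$ and $\omega_{-b}\ne0$. Then, in $K[u][[z]]$, $$\sum_{k\ge0}\sum_{\ell=0}^{k}F_{k,\ell}\,u^\ell z^k=\frac{\widetilde N(u,z)}{\widetilde D(uz)\,D(z)},$$ where $D(z)=\det(1-z\mathbf T)$, $\widetilde D(z)=\det(1-z\widetilde{\mathbf T})$, and $\widetilde N(u,z)$ is the $(\widetilde I_0,I_0)$ entry of the matrix $\operatorname{adj}(1-uz\widetilde{\mathbf T})\,\mathbf U\,\operatorname{adj}(1-z\mathbf T)$ (adj denoting the adjugate, i.e. the transposed cofactor matrix), a polynomial in $u,z$. Moreover $D(z)$ has degree $\binom{a+b}{a}$, $\widetilde D(z)$ has degree $\binom{a+b}{a-1}$, and, as a polynomial in $z$, $\widetilde N(u,z)$ has degree $\binom{a+b+1}{a}-a-b-1$ with leading coefficient equal to $c\,u^{\binom{a+b}{a-1}-a}$ for some nonzero $c\in K$.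
   Context: Let $S$ be a finite set of integers with $a:=\max S\ge 1$ and $b:=-\min S\ge 1$. Each $s\in S$ carries a weight $\omega_s$ in a field $K$ of characteristic $0$; set $\omega_s:=0$ for $s\in\mathbb Z\setminus S$, and for $s\in\mathbb Z$ put $\beta_s:=\delta_{s,0}-\omega_s$ and $\widetilde\beta_s:=-\beta_{s+1}$. For $k\ge0$, $A_k$ is the $(k+1)\times(k+1)$ matrix with rows and columns indexed by $0,\dots,k$ whose $(i,j)$ entry is $\omega_{j-i}$. For $0\le\ell\le k$, $F_{k,\ell}$ is the $(\ell,0)$ cofactor of $1-A_k$, i.e. $(-1)^\ell$ times the determinant of the matrix obtained from $1-A_k$ by deleting row $\ell$ and column $0$. Notation: $[m,n]:=\{i\in\mathbb Z: m\le i\le n\}$, $X+c:=\{x+c:x\in X\}$; an $n$-subset is a subset of cardinality $n$. $I_0:=[0,a-1]$, $\widetilde I_0:=[0,a-2]$ (empty if $a=1$). For a finite set $I\subseteq\mathbb Z$ and $s\in\mathbb Z$, $\epsilon_s(I):=(-1)^{\#\{i\in I:\ i<s\}}$. $\mathbf T$ is the square matrix with rows and columns indexed by the $a$-subsets of $[-b,a-1]$ and entries $\mathbf T[I,J]:=\epsilon_s(I)\beta_s$ if there is an integer $s$ with $I\cup\{a\}=(J+1)\cup\{s\}$ (such $s$ is then unique), and $0$ otherwise. $\widetilde{\mathbf T}$ is the square matrix indexed by the $(a-1)$-subsets of $[-b-1,a-2]$ with $\widetilde{\mathbf T}[I,J]:=\epsilon_s(I)\widetilde\beta_s$ if there is an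 integer $s$ with $I\cup\{a-1\}=(J+1)\cup\{s\}$, and $0$ otherwise. $\mathbf U$ is the matrix with rows indexed by the $(a-1)$-subsets of $[-b-1,a-2]$ and columns by the $a$-subsets of $[-b,a-1]$, with $\mathbf U[I,J]=1$ if $I\cup\{a-1\}=J$ and $0$ otherwise. *)

(* Defs.v *)
From HB Require Import structures.
From mathcomp Require Import all_boot all_order all_algebra.
Set Implicit Arguments. Unset Strict Implicit. Unset Printing Implicit Defensive.
Import Order.TTheory GRing.Theory Num.Theory.
Local Open Scope ring_scope.

Section Defs.
Variable K : fieldType.
Variables (a b : nat) (omega : int -> K).

Definition beta (s : int) : K := (s == 0)%:R - omega s.
Definition betat (s : int) : K := - beta (s + 1).

Definition Amx (k : nat) : 'M[K]_k.+1 :=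
  \matrix_(i < k.+1, j < k.+1) omega (j%:Z - i%:Z).

Definition Fkl (k l : nat) : K := cofactor (1%:M - Amx k) (inord l) ord0.

Definition Grow (k : nat) : {poly K} := \sum_(l < k.+1) Fkl k l *: 'X^l.

(* Finite sets of integers.  A subset of an interval [-off, n-1-off] is
   encoded as a subset I of 'I_n, element i standing for the integer i - off. *)
Definition Zof (n : nat) (off : int) (I : {set 'I_n}) : seq int :=
  [seq ((nat_of_ord i)%:Z - off) | i <- enum I].

Definition seq_eqset (A B : seq int) : bool :=
  all (fun x => x \in B) A && all (fun x => x \in A) B.

Definition eps (s : int) (I : seq int) : K :=
  (-1) ^+ count (fun i => i < s) I.

(* Entry "eps_s(I) bt_s if there is an integer s with I u {top} = (J+1) u {s},
   else 0".  Any such s lies in I u {top}, so it suffices to search there. *)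
Definition Tentry (bt : int -> K) (top : int) (I J : seq int) : K :=
  match [seq s <- top :: I | seq_eqset (top :: I) (s :: [seq j + 1 | j <- J])] with
  | s :: _ => eps s I * bt s
  | [::] => 0
  end.

Definition KS (n k : nat) : {set {set 'I_n}} := [set A : {set 'I_n} | #|A| == k].

Definition ksub (n k : nat) (i : 'I_#|KS n k|) : {set 'I_n} := enum_val i.

(* T : indexed by a-subsets of [-b, a-1]  (encoding 'I_(a+b), offset b) *)
Definition Tmx : 'M[K]_#|KS (a + b) a| :=
  \matrix_(i, j) Tentry beta a%:Z (Zof b%:Z (ksub i)) (Zof b%:Z (ksub j)).

(* tilde T : indexed by (a-1)-subsets of [-b-1, a-2] (encoding 'I_(a+b), offset b+1) *)
Definition Ttmx : 'M[K]_#|KS (a + b) a.-1| :=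
  \matrix_(i, j) Tentry betat (a%:Z - 1) (Zof (b.+1)%:Z (ksub i))
                                          (Zof (b.+1)%:Z (ksub j)).

Definition Umx : 'M[K]_(#|KS (a + b) a.-1|, #|KS (a + b) a|) :=
  \matrix_(i, j) (seq_eqset ((a%:Z - 1) :: Zof (b.+1)%:Z (ksub i))
                            (Zof b%:Z (ksub j)))%:R.

Definition Dpoly : {poly K} := \det (1%:M - 'X *: map_mx polyC Tmx).
Definition Dtpoly : {poly K} := \det (1%:M - 'X *: map_mx polyC Ttmx).

Definition lift2 (c : K) : {poly {poly K}} := c%:P%:P.
Definition zvar : {poly {poly K}} := 'X.
Definition uvar : {poly {poly K}} := ('X : {poly K})%:P.

Definition Dz : {poly {poly K}} := \det (1%:M - zvar *: map_mx lift2 Tmx).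
Definition Dtuz : {poly {poly K}} :=
  \det (1%:M - (uvar * zvar) *: map_mx lift2 Ttmx).

End Defs.

Lemma card_setge (n m : nat) : #|[set i : 'I_n | (m <= i)%N]| = (n - m)%N.
Proof.
rewrite cardsE -sum1_card big_mkcond /=.
rewrite -(big_mkord xpredT (fun i => if (m <= i)%N then 1%N else 0%N)).
elim: n => [|n IH]; first by rewrite big_geq.
rewrite big_nat_recr //= IH; case: (leqP m n) => H.
  by rewrite addn1 subSn.
by rewrite addn0 (eqP (ltnW H)) (eqP H).
Qed.

(* I_0 = [0, a-1] as an a-subset of [-b, a-1] (offset b) *)
Definition I0set (a b : nat) : {set 'I_(a + b)} := [set i : 'I_(a + b) | (b <= i)%N].
(* tilde I_0 = [0, a-2] as an (a-1)-subset of [-b-1, a-2] (offset b+1) *)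
Definition It0set (a b : nat) : {set 'I_(a + b)} := [set i : 'I_(a + b) | (b.+1 <= i)%N].

Lemma I0_in (a b : nat) : I0set a b \in KS (a + b) a.
Proof. by rewrite inE card_setge addnK. Qed.

Lemma It0_in (a b : nat) : It0set a b \in KS (a + b) a.-1.
Proof. by rewrite inE card_setge subnS addnK. Qed.

Definition Ntpoly (K : fieldType) (a b : nat) (omega : int -> K) : {poly {poly K}} :=
  ((\adj (1%:M - (uvar K * zvar K) *: map_mx (@lift2 K) (@Ttmx K a b omega)))
     *m map_mx (@lift2 K) (@Umx K a b)
     *m \adj (1%:M - zvar K *: map_mx (@lift2 K) (@Tmx K a b omega)))
    (enum_rank_in (It0_in a b) (It0set a b)) (enum_rank_in (I0_in a b) (I0set a b)).

(* Main.v *)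
(** Expand a banded Toeplitz determinant along its first row, again and again.
The columns not yet used always form a set [I] of fixed cardinality inside a
window that slides by one at each row, so the expansion is a power of the
transfer matrix; in the cofactor [F_{k,l}] the rows above the deleted row [l]
see the columns shifted by one (matrix [Tt], parameters [betat]), deleting row
[l] is the matrix [U], and the remaining rows give [T].  Hence
[F_{k,l} = (Tt^l U T^(k-l))[It0, I0]], which sums to
[(1 - uz Tt)^-1 U (1 - z T)^-1].

For the degrees, [T] is invertible: a row indexed by a set containing the least
point of the window has a single nonzero entry, and so has a column indexed by
a set missing the greatest point.  This gives [deg det (1 - zT)], and the
coefficient of [z^(N-m)] in [adj (1 - zT)] is
[- \sum_(1 <= i <= m) d_(N-m+i) T^-i], where [d_j] are the coefficients of
[det (1 - zT)].  So the top terms of the numerator are governed by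
[(Tt^-i U T^-j)[It0, I0]], [i, j >= 1].  The monomial rows and columns make the
negative powers explicit: row [It0] of [Tt^-i U] vanishes for [i < a] and
column [I0] of [U T^-j] vanishes for [j < b+1], while the entry for
[i = a], [j = b+1] is nonzero. *)

Require Import Defs.
From HB Require Import structures.
From mathcomp Require Import all_boot all_order all_algebra.
From mathcomp Require Import zify.
Set Implicit Arguments. Unset Strict Implicit. Unset Printing Implicit Defensive.
Import Order.TTheory GRing.Theory Num.Theory.
Local Open Scope ring_scope.

(** * Subsets of a window as sorted lists *)

Definition elems n (A : {set 'I_n}) : seq nat := [seq val i | i <- enum A].

(* [I u {top}] and [J + 1] in the window enlarged by one point, as in [T[I, J]]. *)
Definition add_top n (I : {set 'I_n}) : {set 'I_n.+1} :=
  ord_max |: [set widen_ord (leqnSn n) i | i in I].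

Definition ord_shift_up n (i : 'I_n) : 'I_n.+1 := lift ord0 i.

Arguments ord_shift_up : simpl never.

Lemma ord_shift_upE n (i : 'I_n) : ord_shift_up i = i.+1 :> nat.
Proof. exact: lift0. Qed.

Definition shift_up n (J : {set 'I_n}) : {set 'I_n.+1} := [set ord_shift_up j | j in J].

Lemma mem_elems n (A : {set 'I_n}) (i : 'I_n) : (val i \in elems A) = (i \in A).
Proof. by rewrite mem_map ?mem_enum //; apply: val_inj. Qed.

Lemma elemsP n (A : {set 'I_n}) (x : nat) :
  reflect (exists2 i : 'I_n, i \in A & x = val i) (x \in elems A).
Proof.
apply: (iffP mapP) => [[i]|[i Ai ->]]; first by rewrite mem_enum; exists i.
by exists i; rewrite ?mem_enum.
Qed.

Lemma size_elems n (A : {set 'I_n}) : size (elems A) = #|A|.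
Proof. by rewrite size_map -cardE. Qed.

Lemma sorted_elems n (A : {set 'I_n}) : sorted ltn (elems A).
Proof.
rewrite /elems; have -> : enum A = [seq x <- enum 'I_n | x \in A].
  by rewrite enumT.
rewrite sorted_map; apply: sorted_filter; first by move=> x y z; apply: ltn_trans.
by have := iota_ltn_sorted 0 n; rewrite -val_enum_ord sorted_map.
Qed.

Lemma uniq_elems n (A : {set 'I_n}) : uniq (elems A).
Proof. by rewrite map_inj_uniq ?enum_uniq //; apply: val_inj. Qed.

Lemma sorted_elems_eq n (A : {set 'I_n}) s :
  sorted ltn s -> elems A =i s -> elems A = s.
Proof.
move=> ss; apply: (irr_sorted_eq ltn_trans ltnn) => //; exact: sorted_elems.
Qed.

Lemma in_add_top_ord n (I : {set 'I_n}) (s : 'I_n.+1) :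
  (s \in add_top I) = (s == n :> nat) || ((s : nat) \in elems I).
Proof.
rewrite !inE; congr (_ || _); apply/imsetP/elemsP => -[i Ii E]; exists i => //.
  by rewrite E.
exact: val_inj.
Qed.

Lemma in_shift_up_ord n (J : {set 'I_n}) (s : 'I_n.+1) :
  (s \in shift_up J) = (0 < s)%N && (s.-1 \in elems J).
Proof.
apply/imsetP/andP => [[j Jj ->]|[s0 /elemsP[j Jj E]]].
  by rewrite ord_shift_upE mem_elems.
by exists j => //; apply: ord_inj; rewrite ord_shift_upE -E prednK.
Qed.

Lemma elems_add_top n (I : {set 'I_n}) : elems (add_top I) = elems I ++ [:: n].
Proof.
apply: sorted_elems_eq.
  rewrite (sorted_pairwise ltn_trans) pairwise_cat; apply/and3P; split=> //.
    by rewrite allrel1r; apply/allP => x /elemsP[i _ ->]; apply: ltn_ord.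
  by rewrite -(sorted_pairwise ltn_trans) sorted_elems.
move=> x; rewrite mem_cat inE orbC; apply/elemsP/idP => [[i + ->]|].
  by rewrite in_add_top_ord.
case/orP => [/eqP->|/elemsP[i Ii ->]].
  by exists ord_max; rewrite ?in_add_top_ord ?eqxx.
exists (widen_ord (leqnSn n) i) => //; rewrite in_add_top_ord /=.
by rewrite mem_elems Ii orbT.
Qed.

Lemma elems_shift_up n (J : {set 'I_n}) : elems (shift_up J) = map succn (elems J).
Proof.
apply: sorted_elems_eq.
  rewrite sorted_map (eq_sorted (e' := ltn)) ?sorted_elems //.
move=> x; apply/elemsP/mapP => [[i + ->]|[y /elemsP[j Jj ->] ->]].
  by rewrite in_shift_up_ord => /andP[i0 Ji]; exists i.-1; rewrite ?prednK.
by exists (ord_shift_up j); rewrite ?ord_shift_upE // in_shift_up_ord ord_shift_upE mem_elems.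
Qed.

Lemma card_add_top n (I : {set 'I_n}) : #|add_top I| = #|I|.+1.
Proof. by rewrite -size_elems elems_add_top size_cat addn1 size_elems. Qed.

Lemma card_shift_up n (I : {set 'I_n}) : #|shift_up I| = #|I|.
Proof. by rewrite -size_elems elems_shift_up size_map size_elems. Qed.

Lemma elems_inj n : injective (@elems n).
Proof.
by move=> A B E; apply/setP => i; rewrite -!mem_elems E.
Qed.

Lemma shift_up_inj n : injective (@shift_up n).
Proof.
move=> I J /(congr1 (@elems _)); rewrite !elems_shift_up => /(inj_map succn_inj).
exact: elems_inj.
Qed.

Lemma ord0_notin_shift_up n (J : {set 'I_n}) : ord0 \notin shift_up J.
Proof. by rewrite in_shift_up_ord. Qed.

Lemma shift_up_surj n (B : {set 'I_n.+1}) : ord0 \notin B -> exists J, B = shift_up J.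
Proof.
move=> B0; exists [set j | ord_shift_up j \in B]; apply/setP => s.
apply/idP/imsetP => [Bs|[j + ->]]; last by rewrite inE.
case: (unliftP ord0 s) => [j|] Es; last by rewrite -Es Bs in B0.
have {}Es : s = ord_shift_up j by [].
by exists j; rewrite // inE -Es.
Qed.

(** * Row expansion of determinants *)

Section Window.
Variable K : comPzRingType.
Implicit Types (f : nat -> nat -> K) (L : seq nat).

(** Columns carry absolute labels, listed in [L], so that deleting a column amounts to [rem]. [N] is
    kept apart from [size L] so that the type of the matrix does not depend on [L]. *)
Definition det_cols f L N : K := \det (\matrix_(i < N, j < N) f i (nth 0%N L j)).

Lemma eq_det_cols f g L N :
  (forall i j, (i < N)%N -> (j < N)%N -> f i (nth 0%N L j) = g i (nth 0%N L j)) ->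
  det_cols f L N = det_cols g L N.
Proof. by move=> E; congr (\det _); apply/matrixP => i j; rewrite !mxE E. Qed.

Lemma det_cols_col0 f L N x : size L = N -> x \in L ->
  (forall i, (i < N)%N -> f i x = 0) -> det_cols f L N = 0.
Proof.
move=> sL Lx f0; have jN : (index x L < N)%N by rewrite -sL index_mem.
rewrite /det_cols (expand_det_col _ (Ordinal jN)) big1 // => i _.
by rewrite mxE /= nth_index // f0 // mul0r.
Qed.

Lemma det_cols_shift f L N : size L = N ->
  det_cols f (map succn L) N = det_cols (fun i c => f i c.+1) L N.
Proof.
move=> sL; congr (\det _); apply/matrixP => i j; rewrite !mxE.
by rewrite (nth_map 0%N) ?sL.
Qed.

Lemma nth_rem_index L x i : uniq L -> x \in L ->
  nth 0%N (rem x L) i = nth 0%N L (bump (index x L) i).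
Proof.
move=> uL xL; rewrite remE nth_cat nth_drop size_take index_mem xL /bump.
case: (ltnP i) => Hi; first by rewrite nth_take.
by rewrite addSn subnKC // add1n.
Qed.

Lemma det_cols_expand f L N : uniq L -> size L = N.+1 ->
  det_cols f L N.+1 =
  \sum_(s <- L) (-1) ^+ index s L * f 0%N s * det_cols (fun i c => f i.+1 c) (rem s L) N.
Proof.
move=> uL sL; rewrite /det_cols (expand_det_row _ ord0) (big_nth 0%N) sL big_mkord.
apply: eq_bigr => j _; rewrite index_uniq ?sL // mxE /cofactor /= add0n.
rewrite mulrA [f _ _ * _]mulrC; congr (_ * \det _).
apply/matrixP => i k; rewrite !mxE /= nth_rem_index ?mem_nth ?sL //.
by rewrite index_uniq ?sL // -lift0.
Qed.

Section Step.
Variables (n p : nat).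

(** A column labelled [0] would be zero. Hence either both sides vanish, or [B] avoids [0], is
    [shift_up J] for exactly one [J], and only the labels change. *)
Lemma det_cols_shift_up (B : {set 'I_n.+1}) f m : #|B| = p ->
  (forall i, (i < p + m)%N -> f i 0%N = 0) ->
  det_cols f (elems B ++ iota n.+1 m) (p + m) =
  \sum_(J in KS n p) (B == shift_up J)%:R *
     det_cols (fun i c => f i c.+1) (elems J ++ iota n m) (p + m).
Proof.
move=> cB f0; have [B0|/shift_up_surj[J BJ]] := boolP (ord0 \in B).
  rewrite (@det_cols_col0 _ _ _ 0%N) //.
  - rewrite big1 // => J _; case: eqP => [E|]; last by rewrite mul0r.
    by rewrite E (negPf (ord0_notin_shift_up J)) in B0.
  - by rewrite size_cat size_elems size_iota cB.
  - by rewrite mem_cat -[0%N]/(val (@ord0 n)) mem_elems B0.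
have cJ : #|J| = p by rewrite -cB BJ card_shift_up.
rewrite (bigD1 J) ?inE ?cJ //= BJ eqxx mul1r big1 ?addr0; last first.
  by move=> J' /andP[_ neq]; rewrite (inj_eq (@shift_up_inj n)) eq_sym (negPf neq) mul0r.
rewrite -det_cols_shift ?size_cat ?size_elems ?size_iota ?cJ //.
by rewrite map_cat -elems_shift_up (iotaDl 1 n).
Qed.

(* The integer [s] of the definition of [T], if any, is unique, so the sum has at
   most one nonzero term. *)
Definition transfer_entry (h : nat -> K) (I J : {set 'I_n}) : K :=
  \sum_(s in add_top I) (add_top I :\ s == shift_up J)%:R *
     ((-1) ^+ #|[set i in add_top I | (i < s)%N]| * h s).

Lemma elems_lt m (A : {set 'I_m}) (s : nat) :
  elems [set i in A | (i < s)%N] = [seq x <- elems A | (x < s)%N].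
Proof.
apply: sorted_elems_eq.
  by rewrite sorted_filter ?sorted_elems //; apply: ltn_trans.
move=> x; rewrite mem_filter; apply/elemsP/andP => [[i + ->]|[xs /elemsP[i Ai E]]].
  by rewrite inE mem_elems => /andP[-> ->].
by exists i => //; rewrite inE Ai -E.
Qed.

Lemma index_elems m (A : {set 'I_m}) (s : 'I_m) : s \in A ->
  index (val s) (elems A) = #|[set i in A | (i < s)%N]|.
Proof.
move=> As; rewrite -size_elems elems_lt.
have : val s \in elems A by rewrite mem_elems.
elim: (elems A) (sorted_elems A) => //= x L IH pL.
have /allP ltL : all (ltn x) L by apply: order_path_min pL; apply: ltn_trans.
rewrite in_cons; case: (eqVneq x (val s)) => [E|neq] /=.
  move=> _; rewrite E ltnn (_ : filter _ _ = [::]) //; apply/eqP.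
  rewrite -[_ == _]negbK -has_filter; apply/hasPn => y Ly.
  by rewrite -leqNgt -E ltnW //; apply: ltL.
move=> Ls; have -> : (x < s)%N := ltL _ Ls.
by rewrite /= IH // (path_sorted pL).
Qed.

Lemma elems_setD1 m (A : {set 'I_m}) (s : 'I_m) : elems (A :\ s) = rem (val s) (elems A).
Proof.
apply: sorted_elems_eq.
  by apply: (subseq_sorted ltn_trans (rem_subseq _ _)); apply: sorted_elems.
move=> x; rewrite mem_rem_uniq ?uniq_elems // !inE; apply/elemsP/andP.
  by case=> i; rewrite !inE => /andP[si Ai] ->; rewrite mem_elems.
by case=> xs /elemsP[i Ai E]; exists i => //; rewrite !inE Ai andbT -val_eqE /= -E.
Qed.

Lemma rem_catl (T : eqType) (x : T) s1 s2 : x \in s1 ->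
  rem x (s1 ++ s2) = rem x s1 ++ s2.
Proof.
elim: s1 => //= y s1 IH; rewrite in_cons; case: eqVneq => //= _ /IH ->.
by [].
Qed.

(** In row [0] the columns beyond [n] vanish, so the expansion only runs over [add_top I]. The
    remaining rows vanish at label [0], which lets the window slide by one. *)
Lemma det_cols_step (I : {set 'I_n}) f m : #|I| = p ->
  (forall c, (n < c)%N -> f 0%N c = 0) ->
  (forall i, (i < p + m)%N -> f i.+1 0%N = 0) ->
  det_cols f (elems I ++ iota n m.+1) (p + m.+1) =
  \sum_(J in KS n p) transfer_entry (f 0%N) I J *
     det_cols (fun i c => f i.+1 c.+1) (elems J ++ iota n m) (p + m).
Proof.
move=> cI f0 f1; have -> : elems I ++ iota n m.+1 = elems (add_top I) ++ iota n.+1 m.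
  by rewrite elems_add_top -catA.
have uL : uniq (elems (add_top I) ++ iota n.+1 m).
  rewrite cat_uniq uniq_elems iota_uniq andbT /=; apply/hasPn => x.
  rewrite mem_iota => /andP[nx _]; apply/negP => /elemsP[i _ E].
  by rewrite E ltnNge -ltnS ltn_ord in nx.
rewrite addnS det_cols_expand //; last first.
  by rewrite size_cat size_elems card_add_top size_iota cI.
rewrite big_cat /= [X in _ + X]big1_seq ?addr0; last first.
  move=> x /andP[_]; rewrite mem_iota => /andP[nx _].
  by rewrite f0 // mulr0 mul0r.
rewrite big_map big_enum /=.
rewrite /transfer_entry; under [RHS]eq_bigr do rewrite mulr_suml.
rewrite exchange_big /=; apply: eq_bigr => s As.
rewrite index_cat mem_elems As index_elems // rem_catl ?mem_elems // -elems_setD1.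
rewrite det_cols_shift_up //; last first.
  by have := cardsD1 s (add_top I); rewrite As card_add_top cI => -[].
by rewrite mulr_sumr; apply: eq_bigr => J _; rewrite mulrCA !mulrA.
Qed.
End Step.
End Window.

(** * Cofactors as entries of products of transfer matrices *)

Section Transfer.
Variable K : fieldType.

Definition transfer_mx (h : nat -> K) n p : 'M[K]_#|KS n p| :=
  \matrix_(i, j) transfer_entry h (ksub i) (ksub j).

Definition bridge_mx n p : 'M[K]_(#|KS n p|, #|KS n p.+1|) :=
  \matrix_(i, j) (add_top (ksub i) == shift_up (ksub j))%:R.

Lemma card_ksub n p (i : 'I_#|KS n p|) : #|ksub i| = p.
Proof. by have := enum_valP i; rewrite inE => /eqP. Qed.

Definition upset n (off : nat) : {set 'I_n} := [set i : 'I_n | (off <= i)%N].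

Lemma elems_upset n off : elems (upset n off) = iota off (n - off).
Proof.
apply: sorted_elems_eq; first exact: iota_ltn_sorted.
move=> x; rewrite mem_iota; apply/elemsP/andP => [[i]|[offx xn]].
  rewrite inE => offi ->; split=> //.
  by rewrite subnKC ?ltn_ord // (leq_trans offi) // ltnW.
have {}xn : (x < n)%N by lia.
by exists (Ordinal xn) => //; rewrite inE.
Qed.

(* Rows [l <= i < k] use [bt] and the rows above them [ct]; the further rows are
   unit vectors sitting at the columns that must remain unused after row [k - 1],
   so that the determinant stays square for every state of the window. *)
Definition window_rows (ct bt : int -> K) (off l k : nat) (i c : nat) : K :=
  if (i < l)%N then ct (c%:Z - i%:Z - off%:Z)
  else if (i < k)%N then bt (c%:Z - i%:Z - off%:Z) else (c == (off + i)%N)%:R.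

Lemma det_cols_transfer n p off (bt : int -> K) m (i j0 : 'I_#|KS n p|) :
  (p + off = n)%N -> ksub j0 = upset n off ->
  (forall s : int, s < - off%:Z -> bt s = 0) ->
  (forall s : int, n%:Z - off%:Z < s -> bt s = 0) ->
  det_cols (window_rows bt bt off 0 m) (elems (ksub i) ++ iota n m) (p + m) =
  (transfer_mx (fun c => bt (c%:Z - off%:Z)) n p ^+ m) i j0.
Proof.
move=> pn Ej0 blo bhi; elim: m i => [|m IH] i.
  rewrite expr0 mxE; case: eqVneq => [->|neq].
    rewrite Ej0 elems_upset cats0 /det_cols.
    rewrite (_ : \matrix_(_, _) _ = 1%:M) ?det1 //; apply/matrixP => s t.
    rewrite !mxE /window_rows /= nth_iota; last by have := ltn_ord t; lia.
    by rewrite eqn_add2l eq_sym.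
  (* A state other than the final one has a column below [off], where all the unit rows vanish. *)
  have /subsetPn[x Ix x0] : ~~ (ksub i \subset upset n off).
    rewrite -Ej0; apply/negP => sub; case/negP: neq; apply/eqP/enum_val_inj.
    by apply/eqP; rewrite eqEcard sub !card_ksub leqnn.
  rewrite (@det_cols_col0 _ _ _ _ (val x)) ?cats0 ?addn0 ?mem_elems //.
    by rewrite size_elems card_ksub.
  move=> r _; rewrite /window_rows /=; case: eqP => // E; case/negP: x0.
  by rewrite inE E leq_addr.
rewrite det_cols_step ?card_ksub //; last first.
- move=> r _; rewrite /window_rows /=; case: ifP => _; first by apply: blo; lia.
  by rewrite addnS.
- by move=> c nc; rewrite /window_rows /=; apply: bhi; lia.
rewrite big_enum_val exprS mxE; apply: eq_bigr => j _; rewrite -IH mxE; congr (_ * _).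
  by apply: eq_bigr => s _; rewrite /window_rows /= subr0.
apply: eq_det_cols => r c _ _; rewrite /window_rows /= ltnS addnS eqSS.
by case: ifP => // _; congr bt; lia.
Qed.

(** Induction on [l] strips the [ct] rows. At [l = 0] the point [n] joins the state without a row
    being consumed: this relabelling is [bridge_mx], and it lowers the offset from [off.+1] to
    [off]. *)
Lemma det_cols_transfer2 n p off (ct bt : int -> K) l m
    (i : 'I_#|KS n p|) (j0 : 'I_#|KS n p.+1|) :
  (p.+1 + off = n)%N -> ksub j0 = upset n off ->
  (forall s : int, s < - off%:Z -> bt s = 0) ->
  (forall s : int, n%:Z - off%:Z < s -> bt s = 0) ->
  (forall s : int, s < - off.+1%:Z -> ct s = 0) ->
  (forall s : int, n%:Z - off.+1%:Z < s -> ct s = 0) ->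
  det_cols (window_rows ct bt off.+1 l (l + m)) (elems (ksub i) ++ iota n (l + m).+1)
    (p + (l + m).+1) =
  (transfer_mx (fun c => ct (c%:Z - off.+1%:Z)) n p ^+ l *m bridge_mx n p *m
   transfer_mx (fun c => bt (c%:Z - off%:Z)) n p.+1 ^+ m) i j0.
Proof.
move=> pn Ej0 blo bhi clo chi; elim: l i => [|l IH] i.
  rewrite expr0 mul1mx add0n.
  have -> : elems (ksub i) ++ iota n m.+1 = elems (add_top (ksub i)) ++ iota n.+1 m.
    by rewrite elems_add_top -catA.
  rewrite addnS -addSn det_cols_shift_up ?card_add_top ?card_ksub //; last first.
    move=> r _; rewrite /window_rows /=; case: ifP => _; first by apply: blo; lia.
    by [].
  rewrite big_enum_val mxE; apply: eq_bigr => j _.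
  rewrite -(det_cols_transfer m j pn Ej0 blo bhi) mxE; congr (_ * _).
  apply: eq_det_cols => r c _ _; rewrite /window_rows /= addSn eqSS.
  by case: ifP => // _; congr bt; lia.
rewrite addSn det_cols_step ?card_ksub //; last first.
- move=> r _; rewrite /window_rows /=; case: ifP => _; first by apply: clo; lia.
  by case: ifP => _; first by apply: blo; lia.
- by move=> c nc; rewrite /window_rows /=; apply: chi; lia.
rewrite big_enum_val exprS -!mulmxA mxE; apply: eq_bigr => j _.
rewrite mulmxA -IH mxE; congr (_ * _).
  by apply: eq_bigr => s _; rewrite /window_rows /= subr0.
apply: eq_det_cols => r c _ _; rewrite /window_rows /= !ltnS addnS eqSS.
by case: ifP => _; [congr ct; lia|case: ifP => // _; congr bt; lia].
Qed.

Lemma det_cols_delta (f : nat -> nat -> K) L k q :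
  (forall i j, (k <= i)%N -> (j < k + q)%N -> f i (nth 0%N L j) = (i == j)%:R) ->
  det_cols f L (k + q) = det_cols f L k.
Proof.
move=> fd; rewrite /det_cols -[RHS]mulr1 -(det1 _ q) -(@det_ublock _ _ _ _
  (\matrix_(i < k, j < q) f i (nth 0%N L (k + j)))); congr (\det _).
apply/matrixP => i j; rewrite -[i]splitK -[j]splitK.
case: (split i) => s; case: (split j) => t /=;
  rewrite ?block_mxEul ?block_mxEur ?block_mxEdl ?block_mxEdr !mxE //=.
  by rewrite fd ?leq_addr ?ltn_addr // gtn_eqF // ltn_addr.
by rewrite fd ?leq_addr ?ltn_add2l // eqn_add2l.
Qed.

Lemma det_scale_rows n (d : 'rV[K]_n) (M : 'M[K]_n) :
  \det (\matrix_(i, j) (d 0 i * M i j)) = (\prod_i d 0 i) * \det M.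
Proof.
rewrite -det_diag -det_mulmx; congr (\det _); apply/matrixP => i j.
by rewrite mul_diag_mx !mxE.
Qed.

(** Once column [0] is deleted, the rows above the deleted row [l] read [beta] one diagonal further,
    and the sign of the cofactor, spread over these [l] rows, turns this into [betat]. The rows
    below move up by one and still read [beta]. *)
Lemma Fkl_transfer p b omega l m
    (i0 : 'I_#|KS (p.+1 + b) p|) (j0 : 'I_#|KS (p.+1 + b) p.+1|) :
  (forall s : int, ~~ (- b%:Z <= s <= p.+1%:Z) -> beta omega s = 0) ->
  ksub i0 = upset _ b.+1 -> ksub j0 = upset _ b ->
  Fkl omega (l + m) l =
  (transfer_mx (fun c => betat omega (c%:Z - b.+1%:Z)) (p.+1 + b) p ^+ l *m
   bridge_mx (p.+1 + b) p *m
   transfer_mx (fun c => beta omega (c%:Z - b%:Z)) (p.+1 + b) p.+1 ^+ m) i0 j0.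
Proof.
move=> b0 Ei0 Ej0; rewrite -det_cols_transfer2 //; last first.
- by move=> s ps; rewrite /betat b0 ?oppr0 //; lia.
- by move=> s ps; rewrite /betat b0 ?oppr0 //; lia.
- by move=> s ps; rewrite b0 //; lia.
- by move=> s ps; rewrite b0 //; lia.
set k := (l + m)%N.
(* The starting columns are consecutive: the one at position [j] has label [b.+1 + j]. *)
have -> : elems (ksub i0) ++ iota (p.+1 + b) k.+1 = iota b.+1 (k + p.+1).
  rewrite Ei0 elems_upset (_ : k + p.+1 = (p.+1 + b - b.+1) + k.+1)%N; last by lia.
  by rewrite iotaD; congr (_ ++ iota _ _); lia.
rewrite (_ : p + k.+1 = k + p.+1)%N; last by lia.
(* The [p.+1] auxiliary unit rows contribute an identity block and drop out. *)
rewrite (@det_cols_delta _ _ k p.+1); last first.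
  move=> i j ki jk; rewrite nth_iota // /window_rows ltnNge (leq_trans (leq_addr m l) ki) /=.
  by rewrite ltnNge ki /= eqn_add2l eq_sym.
rewrite /Fkl /cofactor inordK ?ltnS ?leq_addr // addn0.
have -> : (-1) ^+ l = \prod_(i < k) (\row_(i < k) (if (i < l)%N then -1 else 1 : K)) 0 i.
  under eq_bigr do rewrite mxE.
  rewrite big_split_ord /= [X in _ * X]big1 ?mulr1; last first.
    by move=> i _; rewrite ltnNge leq_addr.
  under eq_bigr do rewrite ltn_ord.
  by rewrite prodr_const card_ord.
rewrite -det_scale_rows /det_cols; congr (\det _); apply/matrixP => i j.
rewrite !mxE /window_rows nth_iota; last by have := ltn_ord j; lia.
rewrite [(i < k)%N]ltn_ord.
have -> : (b.+1 + j)%N%:Z - i%:Z - b.+1%:Z = j%:Z - i%:Z by lia.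
rewrite -val_eqE /= inordK ?ltnS ?leq_addr //= /bump /= add1n.
rewrite /betat /beta.
case: (ltnP i l) => il.
  rewrite add0n mulN1r; congr (- (_ - omega _)); last by lia.
  by congr (_%:R); lia.
rewrite mul1r add1n; congr (_ - omega _); last by lia.
by congr (_%:R); lia.
Qed.
End Transfer.

Lemma seq_eqsetP (A B : seq int) : reflect (A =i B) (seq_eqset A B).
Proof.
apply: (iffP andP) => [[/allP AB /allP BA] x|AB].
  by apply/idP/idP => [/AB|/BA].
by split; apply/allP => x; rewrite AB.
Qed.

(** * The matrices of the statement *)

Section Encoding.
Implicit Type off : int.

Definition zcode off (c : nat) : int := c%:Z - off.

Lemma zcode_inj off : injective (zcode off).
Proof. by move=> x y; rewrite /zcode; lia. Qed.

Lemma ZofE n off (I : {set 'I_n}) : Zof off I = map (zcode off) (elems I).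
Proof. by rewrite /Zof /elems -map_comp. Qed.

Lemma Zof_shift_up n off (J : {set 'I_n}) :
  [seq j + 1 | j <- Zof off J] = Zof off (shift_up J).
Proof.
rewrite !ZofE elems_shift_up -!map_comp; apply: eq_map => x /=.
by rewrite /zcode; lia.
Qed.

Lemma Zof_add_top n off (I : {set 'I_n}) :
  perm_eq (n%:Z - off :: Zof off I) (Zof off (add_top I)).
Proof. by rewrite !ZofE elems_add_top map_cat -cat1s perm_catC. Qed.

Lemma mem_Zof n off (I : {set 'I_n}) (s : 'I_n) :
  (zcode off s \in Zof off I) = (s \in I).
Proof. by rewrite ZofE mem_map ?mem_elems //; apply: zcode_inj. Qed.

Lemma Zof_mem n off (I : {set 'I_n}) x : x \in Zof off I ->
  exists2 s, s \in I & x = zcode off s.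
Proof. by rewrite ZofE => /mapP[c /elemsP[s Is ->] ->]; exists s. Qed.

Lemma uniq_Zof n off (I : {set 'I_n}) : uniq (Zof off I).
Proof. by rewrite ZofE map_inj_uniq ?uniq_elems //; apply: zcode_inj. Qed.

Lemma Zof_setU1 n off (s : 'I_n) (B : {set 'I_n}) :
  zcode off s :: Zof off B =i Zof off (s |: B).
Proof.
move=> x; rewrite in_cons; apply/orP/idP => [[/eqP->|/Zof_mem[t Bt ->]]|].
- by rewrite mem_Zof setU11.
- by rewrite mem_Zof setU1r.
case/Zof_mem => t; rewrite !inE => /orP[/eqP->|Bt] ->; first by left.
by right; rewrite mem_Zof.
Qed.

Lemma eq_Zof n off (A B : {set 'I_n}) : Zof off A =i Zof off B -> A = B.
Proof. by move=> E; apply/setP => s; rewrite -!(mem_Zof off) E. Qed.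

(** Equal cardinalities force [s] outside [J + 1], so adjoining [s] to [J + 1] can be read as
    removing [s] from [add_top I]. *)
Lemma match_setE n off (I J : {set 'I_n}) (s : 'I_n.+1) : #|I| = #|J| ->
  s \in add_top I ->
  seq_eqset (n%:Z - off :: Zof off I) (zcode off s :: [seq j + 1 | j <- Zof off J])
  = (add_top I :\ s == shift_up J).
Proof.
move=> cIJ As; rewrite Zof_shift_up; apply/seq_eqsetP/eqP => [E|E x]; last first.
  by rewrite (perm_mem (Zof_add_top _ _)) Zof_setU1 -E setD1K.
have {}E : add_top I = s |: shift_up J.
  by apply: (@eq_Zof _ off) => x; rewrite -(perm_mem (Zof_add_top _ _)) E Zof_setU1.
have : #|add_top I| = #|s |: shift_up J| by rewrite -E.
rewrite cardsU1 card_add_top card_shift_up cIJ => cE.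
have sJ : s \notin shift_up J by case: (_ \in _) cE => //=; lia.
by rewrite E setU1K.
Qed.

(** The first match found by the list search is the only one, so the search agrees with the sum. *)
Lemma Tentry_transfer_entry (K : fieldType) n off (bt : int -> K) (I J : {set 'I_n}) :
  #|I| = #|J| ->
  Tentry bt (n%:Z - off) (Zof off I) (Zof off J) =
  transfer_entry (fun c => bt (c%:Z - off)) I J.
Proof.
move=> cIJ; set top := n%:Z - off; set A := top :: Zof off I.
set P := fun s => seq_eqset A (s :: [seq j + 1 | j <- Zof off J]).
have -> : transfer_entry (fun c => bt (c%:Z - off)) I J =
    \sum_(s <- A | P s) eps K s (Zof off I) * bt s.
  rewrite (perm_big _ (Zof_add_top off I)) /= big_mkcond ZofE big_map /elems big_map big_enum /=.
  apply: eq_bigr => s As; rewrite /P match_setE //.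
  case: eqP => _; last by rewrite mul0r.
  rewrite mul1r /eps; congr ((-1) ^+ _ * _).
  (* The added point [n] is never below [s], so it does not affect the sign. *)
  rewrite -size_elems elems_lt size_filter elems_add_top count_cat /= addn0.
  rewrite [(n < s)%N]ltnNge -ltnS ltn_ord addn0 ZofE count_map.
  by apply: eq_count => x /=; rewrite /zcode; lia.
rewrite -big_filter /Tentry -/A -/P.
have uF : uniq [seq s <- A | P s].
  by rewrite filter_uniq // (perm_uniq (Zof_add_top off I)) uniq_Zof.
(* If [s] and [t] differed, [s] would lie in [J + 1], while cardinalities force [s] followed by
   [J + 1] to be free of repetitions. *)
have PF s t : P s -> P t -> s = t.
  move=> /seq_eqsetP Es /seq_eqsetP Et; apply/eqP.
  have : s \in A by rewrite Es mem_head.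
  rewrite Et in_cons => /orP[//|sJ].
  have uA : uniq A by rewrite (perm_uniq (Zof_add_top off I)) uniq_Zof.
  have: uniq (s :: [seq j + 1 | j <- Zof off J]).
    rewrite -(eq_uniq _ Es) //=.
    by rewrite size_map !ZofE !size_map -!cardE cIJ.
  by rewrite /= sJ.
case EF : [seq s <- A | P s] => [|s [|t F]]; rewrite ?big_nil ?big_seq1 //.
have : s = t by apply: PF; have: all P [seq s <- A | P s] by [exact: filter_all];
  rewrite EF => /= /and3P[].
by move=> E; move: uF; rewrite EF E /= mem_head.
Qed.
End Encoding.

Section Identification.
Variables (K : fieldType) (p b : nat) (omega : int -> K).
Local Notation n := (p.+1 + b)%N.

Lemma TmxE : Tmx p.+1 b omega = transfer_mx (fun c => beta omega (c%:Z - b%:Z)) n p.+1.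
Proof.
apply/matrixP => i j; rewrite !mxE -Tentry_transfer_entry ?card_ksub //.
by congr Tentry; lia.
Qed.

Lemma TtmxE : Ttmx p.+1 b omega = transfer_mx (fun c => betat omega (c%:Z - b.+1%:Z)) n p.
Proof.
apply/matrixP => i j; rewrite !mxE -Tentry_transfer_entry ?card_ksub //.
by congr Tentry; lia.
Qed.

(** Rows use offset [b.+1] and columns offset [b]; a set read with offset [b] is its [shift_up] read
    with offset [b.+1]. *)
Lemma UmxE : Umx K p.+1 b = bridge_mx K n p.
Proof.
apply/matrixP => i j; rewrite !mxE; congr ((nat_of_bool _)%:R).
have -> : p.+1%:Z - 1 = n%:Z - b.+1%:Z by lia.
have -> : Zof b%:Z (ksub j) = Zof b.+1%:Z (shift_up (ksub j)).
  rewrite !ZofE elems_shift_up -map_comp; apply: eq_map => x /=.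
  by rewrite /zcode; lia.
apply/seq_eqsetP/eqP => [E|<- x]; last by rewrite (perm_mem (Zof_add_top _ _)).
by apply: (@eq_Zof _ b.+1%:Z) => x; rewrite -E (perm_mem (Zof_add_top _ _)).
Qed.
End Identification.

(** * Invertibility of the transfer matrix *)

Section Spectrum.
Variables (K : fieldType) (n : nat) (h : nat -> K).
Hypotheses (h0 : h 0%N != 0) (hn : h n != 0).

(** A unit row vector if [#|I| = p] and zero otherwise, which avoids carrying a membership proof. *)
Definition dvec p (I : {set 'I_n}) : 'rV[K]_#|KS n p| := \row_j (ksub j == I)%:R.

Lemma ksubP p (I : {set 'I_n}) : #|I| = p -> exists i : 'I_#|KS n p|, ksub i = I.
Proof.
move=> cI; have KI : I \in KS n p by rewrite inE cI.
by exists (enum_rank_in KI I); rewrite /ksub enum_rankK_in.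
Qed.

Lemma dvec_ksub p (i : 'I_#|KS n p|) : dvec p (ksub i) = delta_mx 0 i.
Proof.
by apply/matrixP => x j; rewrite !mxE (inj_eq enum_val_inj) ord1.
Qed.

Lemma dvec_mulmx p q (M : 'M[K]_(#|KS n p|, q)) i : dvec p (ksub i) *m M = row i M.
Proof. by rewrite dvec_ksub -rowE. Qed.

Lemma in_add_top_max (I : {set 'I_n}) : ord_max \in add_top I.
Proof. by rewrite setU11. Qed.

Lemma in_shift_up_max (J : {set 'I_n}) : (ord_max \in shift_up J) = (n.-1 \in elems J).
Proof.
rewrite in_shift_up_ord /=; case: n J => // J; rewrite andFb; symmetry.
by apply/negbTE; apply/elemsP => -[[]].
Qed.

Lemma elems_gt0 (I : {set 'I_n}) x : x \in elems I -> (0 < n)%N.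
Proof. by case/elemsP => i _ _; apply: leq_ltn_trans (ltn_ord i). Qed.

Lemma ord0_in_add_top (I : {set 'I_n}) : (0 < n)%N -> (ord0 \in add_top I) = (0%N \in elems I).
Proof. by move=> n0; rewrite in_add_top_ord /= eq_sym gtn_eqF. Qed.

(** [J + 1] never contains [0], so [0] is the only point that can be removed, and nothing lies below
    it. *)
Lemma transfer_entry_bottom (I J : {set 'I_n}) : 0%N \in elems I ->
  transfer_entry h I J = (add_top I :\ ord0 == shift_up J)%:R * h 0%N.
Proof.
move=> I0; have A0 : ord0 \in add_top I by rewrite ord0_in_add_top // (elems_gt0 I0).
rewrite /transfer_entry (bigD1 ord0) //= big1 ?addr0 => [|s /andP[_ s0]].
  rewrite (_ : [set i in _ | _] = set0) ?cards0 ?mul1r //.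
  by apply/setP => i; rewrite !inE ltn0 andbF.
case: eqP => [E|]; last by rewrite mul0r.
by have := ord0_notin_shift_up J; rewrite -E !inE eq_sym s0 -in_setU1 A0.
Qed.

(** Here [J + 1] misses [n], so [n] itself must be removed, and all [p] points of [I] lie below
    it. *)
Lemma transfer_entry_top p (I J : {set 'I_n}) : #|I| = p -> n.-1 \notin elems J ->
  transfer_entry h I J = (add_top I :\ ord_max == shift_up J)%:R * ((-1) ^+ p * h n).
Proof.
move=> cI Jn; rewrite /transfer_entry (bigD1 ord_max) ?in_add_top_max //= big1 ?addr0; last first.
  move=> s /andP[_ sn]; case: eqP => [E|]; last by rewrite mul0r.
  by have := in_shift_up_max J; rewrite (negPf Jn) -E in_setD1 eq_sym sn in_add_top_max.
congr (_ * ((-1) ^+ _ * _)); rewrite -size_elems elems_lt size_filter elems_add_top count_cat /=.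
rewrite ltnn !addn0 -cI -size_elems -[RHS]count_predT; apply: eq_in_count => x.
by case/elemsP => i _ ->; rewrite ltn_ord.
Qed.

Lemma dvec_transfer_mx_bottom p (I J : {set 'I_n}) : #|I| = p ->
  0%N \in elems I -> add_top I :\ ord0 = shift_up J ->
  dvec p I *m transfer_mx h n p = h 0%N *: dvec p J.
Proof.
move=> cI I0 E; have [i Ei] := ksubP cI; rewrite -{1}Ei dvec_mulmx.
apply/rowP => j; rewrite !mxE Ei transfer_entry_bottom // E (inj_eq (@shift_up_inj n)).
by rewrite eq_sym mulrC.
Qed.

Lemma transfer_mx_dvec_top p (I J : {set 'I_n}) : #|J| = p ->
  add_top I :\ ord_max = shift_up J ->
  transfer_mx h n p *m (dvec p J)^T = ((-1) ^+ p * h n) *: (dvec p I)^T.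
Proof.
move=> cJ E; have [j Ej] := ksubP cJ.
have Jn : n.-1 \notin elems J by rewrite -in_shift_up_max -E setD11.
apply/colP => i; rewrite -{1}Ej dvec_ksub trmx_delta -colE !mxE Ej.
rewrite (transfer_entry_top (card_ksub i)) // mulrC; congr (_ * (nat_of_bool _)%:R).
rewrite -E; apply/eqP/eqP => [EE|->] //; apply: elems_inj.
have := congr1 (fun A => elems (ord_max |: A)) EE.
by rewrite !setD1K ?in_add_top_max // !elems_add_top !cats1 => /rcons_inj[].
Qed.

Lemma add_top_surj (B : {set 'I_n.+1}) : ord_max \in B -> exists I, B = add_top I.
Proof.
move=> Bn; exists [set i | widen_ord (leqnSn n) i \in B]; apply/setP => s.
rewrite in_add_top_ord; case: (eqVneq (s : nat) n) => [E|neq] /=.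
  by rewrite (_ : s = ord_max) //; apply: ord_inj.
have sn : (s < n)%N by rewrite ltn_neqAle neq -ltnS ltn_ord.
rewrite -[val s]/(val (Ordinal sn)) mem_elems inE; congr (_ \in B).
exact: ord_inj.
Qed.

Lemma card_bottom (I J : {set 'I_n}) : 0%N \in elems I -> add_top I :\ ord0 = shift_up J ->
  #|I| = #|J|.
Proof.
move=> I0 E; have n0 := elems_gt0 I0.
have := cardsD1 ord0 (add_top I); rewrite E card_add_top card_shift_up ord0_in_add_top // I0.
by case.
Qed.

Lemma card_top (I J : {set 'I_n}) : add_top I :\ ord_max = shift_up J -> #|I| = #|J|.
Proof.
move=> E; have := cardsD1 ord_max (add_top I).
by rewrite E card_add_top card_shift_up in_add_top_max => -[].
Qed.

Lemma bottom_exists (J : {set 'I_n}) : n.-1 \in elems J ->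
  exists2 I : {set 'I_n}, 0%N \in elems I & add_top I :\ ord0 = shift_up J.
Proof.
move=> Jn; have n0 := elems_gt0 Jn.
have /add_top_surj[I EI] : ord_max \in ord0 |: shift_up J by rewrite setU1r // in_shift_up_max.
exists I; first by rewrite -ord0_in_add_top // -EI setU11.
by rewrite -EI setU1K // ord0_notin_shift_up.
Qed.

Lemma top_exists (J : {set 'I_n}) : n.-1 \notin elems J ->
  exists I : {set 'I_n}, add_top I :\ ord_max = shift_up J.
Proof.
move=> Jn; have /add_top_surj[I EI] : ord_max \in ord_max |: shift_up J by rewrite setU11.
by exists I; rewrite -EI setU1K // in_shift_up_max.
Qed.

Lemma row_sum_dvec p (w : 'rV[K]_#|KS n p|) : w = \sum_j w 0 j *: dvec p (ksub j).
Proof. by rewrite {1}[w]row_sum_delta; apply: eq_bigr => j _; rewrite dvec_ksub. Qed.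

(* Rows indexed by sets containing [0] are monomial, and their supports exhaust
   the sets containing [n - 1]. *)
Lemma top_image p (w : 'rV[K]_#|KS n p|) :
  (forall j, n.-1 \notin elems (ksub j) -> w 0 j = 0) ->
  exists2 v, v *m transfer_mx h n p = w & forall i, 0%N \notin elems (ksub i) -> v 0 i = 0.
Proof.
(* [D] projects onto the sets containing [0]; solving through [D] keeps the preimage supported
   there. *)
move=> w0; pose D := diag_mx (\row_(i < #|KS n p|) (0%N \in elems (ksub i))%:R : 'rV[K]__).
have /submxP[v Ev] : (w <= D *m transfer_mx h n p)%MS.
  rewrite [w]row_sum_dvec; apply: summx_sub => j _.
  have [Jn|Jn] := boolP (n.-1 \in elems (ksub j)); last by rewrite w0 // scale0r sub0mx.
  have [I I0 E] := bottom_exists Jn; have cI := card_bottom I0 E.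
  have [i Ei] := ksubP (etrans cI (card_ksub j)).
  have EJ : dvec p (ksub j) = (h 0%N)^-1 *: (dvec p I *m transfer_mx h n p).
    by rewrite (dvec_transfer_mx_bottom _ I0 E) ?scalerA ?mulVf ?scale1r // cI card_ksub.
  rewrite EJ !scalemx_sub // -Ei.
  have -> : dvec p (ksub i) = dvec p (ksub i) *m D.
    apply/rowP => k; rewrite mul_mx_diag !mxE.
    by case: eqP => [->|_]; rewrite ?mul0r // Ei I0 mulr1.
  by rewrite -mulmxA submxMl.
exists (v *m D); first by rewrite -mulmxA.
by move=> i /negPf i0; rewrite mul_mx_diag !mxE i0 mulr0.
Qed.

(** Among the columns missing [n - 1], row [I] is nonzero only at [J]. Subtracting the scaled row
    from [dvec p J] leaves a vector supported on sets containing [n - 1], to which [top_image]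
    applies. *)
Lemma dvec_transfer_mx_top p (I J : {set 'I_n}) : #|J| = p ->
  add_top I :\ ord_max = shift_up J ->
  exists2 v, (((-1) ^+ p * h n)^-1 *: dvec p I + v) *m transfer_mx h n p = dvec p J
    & forall i, 0%N \notin elems (ksub i) -> v 0 i = 0.
Proof.
move=> cJ E; set c := _ * _; have c0 : c != 0 by rewrite mulf_neq0 ?signr_eq0.
have [|v Ev v0] := @top_image p (dvec p J - c^-1 *: (dvec p I *m transfer_mx h n p)).
  move=> j Jn; have [i Ei] := ksubP (etrans (card_top E) cJ).
  rewrite -Ei dvec_mulmx !mxE Ei (transfer_entry_top (etrans (card_top E) cJ) Jn) -/c E.
  by rewrite (inj_eq (@shift_up_inj n)) eq_sym mulrC mulfK // subrr.
by exists v => //; rewrite mulmxDl Ev -scalemxAl addrC subrK.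
Qed.

(** Every unit vector lies in the row space; the two cases are whether its set contains [n - 1]. *)
Lemma transfer_mx_unit p : transfer_mx h n p \in unitmx.
Proof.
rewrite -row_full_unit -sub1mx; apply/row_subP => j; rewrite row1 -dvec_ksub.
have [Jn|Jn] := boolP (n.-1 \in elems (ksub j)).
  have [|v <- _] := @top_image p (dvec p (ksub j)); last exact: submxMl.
  by move=> k kn; rewrite mxE; case: eqP kn => // ->; rewrite Jn.
have [I E] := top_exists Jn.
by have [v <- _] := dvec_transfer_mx_top (card_ksub j) E; apply: submxMl.
Qed.

Lemma dvec_bridge_mx_bottom p (I : {set 'I_n}) : #|I| = p -> 0%N \in elems I ->
  dvec p I *m bridge_mx K n p = 0.
Proof.
move=> cI I0; have [i Ei] := ksubP cI; rewrite -Ei dvec_mulmx.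
have n0 := elems_gt0 I0.
apply/rowP => j; rewrite !mxE Ei; case: eqP => // E.
by have := ord0_notin_shift_up (ksub j); rewrite -E ord0_in_add_top ?I0.
Qed.

Lemma dvec_bridge_mx p (I J : {set 'I_n}) : #|I| = p -> add_top I = shift_up J ->
  dvec p I *m bridge_mx K n p = dvec p.+1 J.
Proof.
move=> cI E; have [i Ei] := ksubP cI; rewrite -Ei dvec_mulmx.
by apply/rowP => j; rewrite !mxE Ei E (inj_eq (@shift_up_inj n)) eq_sym.
Qed.

Lemma bridge_mx_dvec_top p (J : {set 'I_n}) : #|J| = p.+1 -> n.-1 \notin elems J ->
  bridge_mx K n p *m (dvec p.+1 J)^T = 0.
Proof.
move=> cJ Jn; have [j Ej] := ksubP cJ.
rewrite -Ej dvec_ksub trmx_delta -colE; apply/colP => i; rewrite !mxE Ej.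
case: eqP => // E; have := in_add_top_max (ksub i).
by rewrite E in_shift_up_max (negPf Jn).
Qed.
End Spectrum.

(** * Negative powers of the transfer matrices *)

Lemma mem_elems_set n (P : pred nat) (x : nat) :
  (x \in elems [set i : 'I_n | P i]) = (x < n)%N && P x.
Proof.
apply/elemsP/andP => [[i + ->]|[xn Px]]; first by rewrite inE ltn_ord.
by exists (Ordinal xn) => //; rewrite inE.
Qed.

Section Extremal.
Variables (K : fieldType) (p b : nat).
Local Notation n := (p.+1 + b)%N.
Let U := bridge_mx K n p.

(* Up to a nonzero factor, row [bot_set 0] of [Tt^-m] is the unit vector at
   [bot_set m], and column [slide_set 0] of [T^-m] the one at [slide_set m]; they
   meet through [U] at [split_set]. *)
Definition bot_set m : {set 'I_n} := [set i : 'I_n | (i < m)%N || (m + b < i)%N].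
Definition slide_set m : {set 'I_n} := [set i : 'I_n | (b <= i + m)%N && (i + m < n)%N].
Definition mid_set : {set 'I_n} := [set i : 'I_n | (0 < i <= p)%N].
Definition split_set : {set 'I_n} := [set i : 'I_n | (i < p)%N || (i == n.-1 :> nat)].

Lemma bot_setS m : (m < p)%N -> add_top (bot_set m.+1) :\ ord0 = shift_up (bot_set m).
Proof.
move=> mp; apply/setP => s; rewrite in_setD1 in_shift_up_ord in_add_top_ord.
rewrite (mem_elems_set _ (fun i => (i < m.+1)%N || (m.+1 + b < i)%N)).
rewrite (mem_elems_set _ (fun i => (i < m)%N || (m + b < i)%N)) -val_eqE /=.
by have := ltn_ord s; lia.
Qed.

Lemma mem0_bot_set m : (0 < m)%N -> 0%N \in elems (bot_set m).
Proof. by move=> m0; rewrite (mem_elems_set _ (fun i => (i < m)%N || (m + b < i)%N)) m0. Qed.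

Lemma card_bot_set m : (m <= p)%N -> #|bot_set m| = p.
Proof.
elim: m => [|m IH] mp; last by rewrite (card_bottom _ (bot_setS mp)) ?mem0_bot_set ?IH // ltnW.
have -> : bot_set 0 = upset n b.+1 by apply/setP => i; rewrite !inE.
by rewrite -size_elems elems_upset size_iota; lia.
Qed.

Lemma mid_set_add_top : add_top mid_set = shift_up split_set.
Proof.
apply/setP => s; rewrite in_shift_up_ord in_add_top_ord.
rewrite (mem_elems_set _ (fun i => (0 < i <= p)%N)).
rewrite (mem_elems_set _ (fun i => (i < p)%N || (i == n.-1))).
by have := ltn_ord s; lia.
Qed.

Lemma mid_set_top : add_top mid_set :\ ord_max = shift_up (bot_set p).
Proof.
apply/setP => s; rewrite in_setD1 in_shift_up_ord in_add_top_ord.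
rewrite (mem_elems_set _ (fun i => (0 < i <= p)%N)).
rewrite (mem_elems_set _ (fun i => (i < p)%N || (p + b < i)%N)) -val_eqE /=.
by have := ltn_ord s; lia.
Qed.

Lemma slide_setS m : (m < b)%N -> add_top (slide_set m) :\ ord_max = shift_up (slide_set m.+1).
Proof.
move=> mb; apply/setP => s; rewrite in_setD1 in_shift_up_ord in_add_top_ord.
rewrite (mem_elems_set _ (fun i => (b <= i + m)%N && (i + m < n)%N)).
rewrite (mem_elems_set _ (fun i => (b <= i + m.+1)%N && (i + m.+1 < n)%N)) -val_eqE /=.
by have := ltn_ord s; lia.
Qed.

Lemma card_slide_set m : (m <= b)%N -> #|slide_set m| = p.+1.
Proof.
elim: m => [|m IH] mb; last by rewrite -(card_top (slide_setS mb)) IH // ltnW.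
have -> : slide_set 0 = upset n b.
  by apply/setP => i; rewrite !inE addn0 ltn_ord andbT.
by rewrite -size_elems elems_upset size_iota addnK.
Qed.

Lemma slide_set_bottom : (0 < b)%N -> add_top (slide_set b) :\ ord0 = shift_up split_set.
Proof.
move=> b0; apply/setP => s; rewrite in_setD1 in_shift_up_ord in_add_top_ord.
rewrite (mem_elems_set _ (fun i => (b <= i + b)%N && (i + b < n)%N)).
rewrite (mem_elems_set _ (fun i => (i < p)%N || (i == n.-1))) -val_eqE /=.
by have := ltn_ord s; lia.
Qed.

Section BotPowers.
Variable ht : nat -> K.
Hypotheses (ht0 : ht 0%N != 0) (htn : ht n != 0).
Let Tt := transfer_mx ht n p.

(** [bot_set m.+1] contains [0], so its row is monomial and points to [bot_set m]; the inverse leads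
    back from [bot_set m] to [bot_set m.+1]. *)
Lemma bot_pow m : (m <= p)%N ->
  exists2 c, c != 0 & dvec K p (bot_set 0) *m invmx Tt ^+ m = c *: dvec K p (bot_set m).
Proof.
elim: m => [|m IH] mp; first by exists 1; rewrite ?oner_eq0 // mulmx1 scale1r.
have [c c0 E] := IH (ltnW mp).
exists (c * (ht 0%N)^-1); first by rewrite mulf_neq0 ?invr_eq0.
rewrite exprSr mulmxA E -scalemxAl -scalerA; congr (_ *: _).
apply: (canLR (mulmxK (transfer_mx_unit ht0 htn p))).
rewrite -scalemxAl (dvec_transfer_mx_bottom _ _ _ (bot_setS mp)) ?mem0_bot_set //;
  last exact: card_bot_set.
by rewrite scalerA mulVf ?scale1r.
Qed.

Lemma bot_pow_U m : (0 < m <= p)%N -> dvec K p (bot_set 0) *m invmx Tt ^+ m *m U = 0.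
Proof.
case/andP=> m0 mp; have [c _ ->] := bot_pow mp.
by rewrite -scalemxAl dvec_bridge_mx_bottom ?scaler0 ?card_bot_set ?mem0_bot_set.
Qed.

(** [bot_set p] misses [n - 1], so the next preimage comes from a monomial column: it is a multiple
    of [mid_set] plus terms at sets containing [0], which [U] kills. *)
Lemma bot_pow_last :
  exists2 c, c != 0 &
    dvec K p (bot_set 0) *m invmx Tt ^+ p.+1 *m U = c *: dvec K p.+1 split_set.
Proof.
have [c c0 E] := bot_pow (leqnn p).
have [v Ev v0] := dvec_transfer_mx_top ht0 htn (card_bot_set (leqnn p)) mid_set_top.
have Ei : dvec K p (bot_set p) *m invmx Tt = ((-1) ^+ p * ht n)^-1 *: dvec K p mid_set + v.
  by rewrite -Ev mulmxK // transfer_mx_unit.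
exists (c * ((-1) ^+ p * ht n)^-1).
  by rewrite mulf_neq0 // invr_eq0 mulf_neq0 ?signr_eq0.
have cmid : #|mid_set| = p by rewrite (card_top mid_set_top) card_bot_set.
rewrite exprSr mulmxA E -scalemxAl Ei -scalemxAl mulmxDl -scalemxAl.
rewrite (dvec_bridge_mx _ cmid mid_set_add_top) (_ : v *m U = 0) ?addr0 ?scalerA //.
rewrite [v]row_sum_dvec mulmx_suml big1 // => j _.
rewrite -scalemxAl; have [j0|j0] := boolP (0%N \in elems (ksub j)).
  by rewrite dvec_bridge_mx_bottom ?scaler0 ?card_ksub.
by rewrite v0 // scale0r.
Qed.

End BotPowers.

Section SlidePowers.
Variable h : nat -> K.
Hypotheses (h0 : h 0%N != 0) (hn : h n != 0).
Let T := transfer_mx h n p.+1.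

(** The mirror image on the right: [slide_set m.+1] misses [n - 1], so its column is monomial and
    points to [slide_set m]. *)
Lemma slide_pow m : (m <= b)%N ->
  exists2 c, c != 0 &
    invmx T ^+ m *m (dvec K p.+1 (slide_set 0))^T = c *: (dvec K p.+1 (slide_set m))^T.
Proof.
elim: m => [|m IH] mb; first by exists 1; rewrite ?oner_eq0 // mul1mx scale1r.
have [c c0 E] := IH (ltnW mb); set d := (-1) ^+ p.+1 * h n.
have d0 : d != 0 by rewrite mulf_neq0 ?signr_eq0.
exists (c * d^-1); first by rewrite mulf_neq0 ?invr_eq0.
rewrite exprS -mulmxA E -scalemxAr -scalerA; congr (_ *: _).
apply: (canLR (mulKmx (transfer_mx_unit h0 hn p.+1))).
rewrite -scalemxAr (transfer_mx_dvec_top _ _ (slide_setS mb)) ?card_slide_set //.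
by rewrite scalerA mulVf ?scale1r.
Qed.

Lemma slide_pow_U m : (0 < m <= b)%N ->
  U *m (invmx T ^+ m *m (dvec K p.+1 (slide_set 0))^T) = 0.
Proof.
case/andP=> m0 mb; have [c _ ->] := slide_pow mb.
rewrite -scalemxAr bridge_mx_dvec_top ?scaler0 ?card_slide_set //.
by rewrite (mem_elems_set _ (fun i => (b <= i + m)%N && (i + m < n)%N)); lia.
Qed.

End SlidePowers.

(** One inverse of [T] acts on the left and turns [split_set] into [slide_set b] through a monomial
    row; the other [b] inverses carry [slide_set 0] to [slide_set b] on the right. *)
Lemma extremal_entry (h ht : nat -> K) :
  h 0%N != 0 -> h n != 0 -> ht 0%N != 0 -> ht n != 0 -> (0 < b)%N ->
  (dvec K p (bot_set 0) *m invmx (transfer_mx ht n p) ^+ p.+1 *m U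
     *m (invmx (transfer_mx h n p.+1) ^+ b.+1 *m (dvec K p.+1 (slide_set 0))^T)) 0 0 != 0.
Proof.
set T := transfer_mx h n p.+1 => h0 hn ht0 htn b0; have [c c0 ->] := bot_pow_last ht0 htn.
have [d d0 Ed] := slide_pow h0 hn (leqnn b).
have ES : dvec K p.+1 split_set *m invmx T = (h 0%N)^-1 *: dvec K p.+1 (slide_set b).
  apply: (canLR (mulmxK (transfer_mx_unit h0 hn p.+1))).
  rewrite -scalemxAl (dvec_transfer_mx_bottom _ _ _ (slide_set_bottom b0)) ?card_slide_set //.
    by rewrite scalerA mulVf ?scale1r.
  by rewrite (mem_elems_set _ (fun i => (b <= i + b)%N && (i + b < n)%N)); lia.
rewrite exprS -mulmxA -scalemxAl [dvec K p.+1 split_set *m _]mulmxA ES Ed.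
rewrite -scalemxAl -scalemxAr !scalerA mxE !mulf_neq0 ?invr_eq0 //.
have [i Ei] := ksubP (card_slide_set (leqnn b)).
by rewrite -Ei dvec_ksub trmx_delta mul_delta_mx mxE !eqxx oner_eq0.
Qed.
End Extremal.

(** * The adjugate of [1 - zT] *)

Section Resolvent.
Variables (K : fieldType) (N : nat) (T : 'M[K]_N).

(** [1 - zT], whose determinant is the reversed characteristic polynomial of [T]. *)
Definition rchar : 'M[{poly K}]_N := 1%:M - 'X *: map_mx polyC T.
Definition coefmx j (M : 'M[{poly K}]_N) : 'M[K]_N := map_mx (fun q : {poly K} => q`_j) M.

Let P := \adj rchar.
Let D := \det rchar.

(** The identity between adjugate and determinant, arranged so that it gives a recursion on the
    coefficients of [P]. *)
Lemma adj_rchar : P = D%:M + 'X *: (P *m map_mx polyC T).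
Proof.
rewrite /D -(mul_adj_mx rchar) -/P /rchar mulmxBr mulmx1.
by rewrite -scalemxAr subrK.
Qed.

Lemma coef_mulC (M : 'M[{poly K}]_N) j : coefmx j (M *m map_mx polyC T) = coefmx j M *m T.
Proof.
apply/matrixP => x y; rewrite !mxE coef_sum; apply: eq_bigr => k _.
by rewrite !mxE coefMC.
Qed.

Lemma coef_adj0 : coefmx 0 P = (D`_0)%:M.
Proof.
rewrite {1}adj_rchar; apply/matrixP => x y.
by rewrite !mxE coefD coefXM addr0 coefMn.
Qed.

Lemma coef_adjS j : coefmx j.+1 P = (D`_j.+1)%:M + coefmx j P *m T.
Proof.
rewrite -coef_mulC {1}adj_rchar; apply/matrixP => x y.
by rewrite !mxE coefD coefXM coefMn.
Qed.

(** The adjugate is the determinant times the geometric series in [zT]. The summands with [m > j]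
    are zero, so a single bound [M] can serve several [j]. *)
Lemma coef_adj_expand j M : (j < M)%N ->
  coefmx j P = \sum_(m < M) ('X^m * D)`_j *: T ^+ m.
Proof.
elim: j M => [|j IH] [|M] // jM; rewrite big_ord_recl expr0 mul1r expr0.
  rewrite coef_adj0 big1 ?addr0 => [|m _]; first by rewrite scalemx1.
  by rewrite coefXnM scale0r.
rewrite coef_adjS (IH M) // mulmx_suml scalemx1; congr (_ + _).
apply: eq_bigr => m _; rewrite lift0 -scalemxAl; congr (_ *: _).
  by rewrite exprS -mulrA coefXM.
by rewrite exprSr.
Qed.

Hypothesis Tu : T \in unitmx.

Lemma det_oppmx_neq0 : \det (- T) != 0.
Proof. by rewrite -unitfE -[_ \is a _]/(- T \in unitmx) -scaleN1r unitmxZ ?unitrN1. Qed.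

(* [1 - zT = (-T)(z - T^-1)] *)
Lemma det_rchar : D = (\det (- T))%:P * char_poly (invmx T).
Proof.
rewrite /D -det_map_mx -det_mulmx /rchar /char_poly_mx mulmxBr -map_mxM /=.
by rewrite mulNmx mulmxV // !map_mxN map_mx1 opprK mulNmx scalar_mxC mul_scalar_mx addrC.
Qed.

Lemma size_det_rchar : size D = N.+1.
Proof. by rewrite det_rchar size_Cmul ?det_oppmx_neq0 // size_char_poly. Qed.

Lemma det_rchar_lead : D`_N != 0.
Proof.
have := size_det_rchar; rewrite -[D`_N]/(D`_(N.+1.-1)) => E; rewrite -E -lead_coefE.
by rewrite lead_coef_eq0 -size_poly_gt0 E.
Qed.

(** From [N] on the recursion has no determinant term and just multiplies by [T]. The entries are
    polynomials, so some later coefficient is zero, and invertibility of [T] brings this back to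
    [j]. *)
Lemma coef_adj_ge j : (N <= j)%N -> coefmx j P = 0.
Proof.
have Pexp d i : (N <= i)%N -> coefmx (i + d) P = coefmx i P *m T ^+ d.
  move=> Ni; elim: d => [|d IH]; first by rewrite addn0 mulmx1.
  rewrite addnS coef_adjS nth_default ?size_det_rchar ?ltnS; last first.
    by rewrite (leq_trans Ni) // leq_addr.
  by rewrite IH exprSr mulmxA raddf0 add0r.
move=> Nj; pose d := (\sum_x \sum_y size (P x y))%N.
have := Pexp d j Nj; rewrite (_ : coefmx (j + d) P = 0).
  move/esym/(congr1 (mulmx^~ (invmx (T ^+ d)))).
  rewrite mul0mx mulmxK //.
  by elim: (d) => [|e IH]; rewrite ?unitmx1 // exprS unitmx_mul Tu.
apply/matrixP => x y; rewrite [LHS]mxE [RHS]mxE nth_default //.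
rewrite (leq_trans _ (leq_addl j d)) // /d (bigD1 x) //= (bigD1 y) //=.
by rewrite -addnA leq_addr.
Qed.

(** Downward induction from the vanishing coefficient at [N], solving the recursion of [coef_adjS]
    for its earlier term. *)
Lemma coef_adj_inv m j : (j + m = N)%N ->
  coefmx j P = - \sum_(i < m) D`_(j + i.+1) *: invmx T ^+ i.+1.
Proof.
elim: m j => [|m IH] j jm.
  by rewrite big_ord0 oppr0 coef_adj_ge // -jm addn0.
have /(congr1 (mulmx^~ (invmx T))) := coef_adjS j.
rewrite mulmxDl mulmxK // IH ?addSnnS // mul_scalar_mx.
move=> /esym/(canRL (addKr _)) ->.
rewrite big_ord_recl expr1 addn1 opprD mulNmx mulmx_suml; congr (_ - _).
apply: eq_bigr => i _; rewrite lift0 -scalemxAl addSnnS; congr (_ *: _).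
by rewrite [RHS]exprSr.
Qed.

End Resolvent.

(** * The generating function *)

Section Substitution.
Variable K : fieldType.

(** In [{poly {poly K}}] the outer variable is [z] and the inner one [u]. Both substitutions are
    ring morphisms, so they commute with [\det] and [\adj]. *)
Definition subst_z : {poly K} -> {poly {poly K}} := map_poly polyC.
Definition subst_uz (q : {poly K}) : {poly {poly K}} := subst_z q \Po (uvar K * zvar K).

HB.instance Definition _ := GRing.RMorphism.copy subst_z (map_poly polyC).
HB.instance Definition _ :=
  GRing.RMorphism.copy subst_uz (comp_poly (uvar K * zvar K) \o subst_z).

Lemma coef_subst_z q j : (subst_z q)`_j = (q`_j)%:P.
Proof. by rewrite coef_map. Qed.

Lemma coef_subst_uz q j : (subst_uz q)`_j = q`_j *: 'X^j.
Proof.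
elim/poly_ind: q j => [|q c IH] j; first by rewrite rmorph0 !coef0 scale0r.
rewrite rmorphD rmorphM /= {2 3}/subst_uz /subst_z map_polyX map_polyC /=.
rewrite comp_polyX comp_polyC /zvar mulrA !coefD !coefMX !coefC.
case: j => [|j] /=; first by rewrite !add0r expr0 alg_polyC.
by rewrite !addr0 /uvar coefMC IH -scalerAl exprSr.
Qed.

Lemma subst_z_Xn m : subst_z 'X^m = 'X^m.
Proof. by rewrite /subst_z map_polyXn. Qed.

Lemma subst_uz_Xn m : subst_uz 'X^m = ('X^m)%:P * 'X^m.
Proof. by rewrite /subst_uz subst_z_Xn comp_Xn_poly exprMn /uvar -polyC_exp. Qed.

Lemma subst_z_rchar N (T : 'M[K]_N) :
  1%:M - zvar K *: map_mx (@lift2 K) T = map_mx subst_z (rchar T).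
Proof.
rewrite /rchar map_mxB map_mx1 map_mxZ /= /subst_z map_polyX -map_mx_comp.
by congr (_ - _ *: _); apply/matrixP => i j; rewrite !mxE /= map_polyC.
Qed.

Lemma subst_uz_rchar N (T : 'M[K]_N) :
  1%:M - (uvar K * zvar K) *: map_mx (@lift2 K) T = map_mx subst_uz (rchar T).
Proof.
rewrite /rchar map_mxB map_mx1 map_mxZ /= {1}/subst_uz /subst_z map_polyX comp_polyX.
rewrite -map_mx_comp; congr (_ - _ *: _); apply/matrixP => i j.
by rewrite !mxE /= /subst_uz /subst_z map_polyC comp_polyC.
Qed.
End Substitution.

Section Main.
Variables (K : fieldType) (p b : nat) (omega : int -> K).
Local Notation n := (p.+1 + b)%N.
Let T := transfer_mx (fun c => beta omega (c%:Z - b%:Z)) n p.+1.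
Let Tt := transfer_mx (fun c => betat omega (c%:Z - b.+1%:Z)) n p.
Let U := bridge_mx K n p.
Let i0 := enum_rank_in (It0_in p.+1 b) (It0set p.+1 b).
Let j0 := enum_rank_in (I0_in p.+1 b) (I0set p.+1 b).
Let P := \adj (rchar T).
Let Pt := \adj (rchar Tt).
Let D := \det (rchar T).
Let Dt := \det (rchar Tt).

Lemma ksub_i0 : ksub i0 = upset n b.+1.
Proof. by rewrite /ksub enum_rankK_in ?It0_in. Qed.

Lemma ksub_j0 : ksub j0 = upset n b.
Proof. by rewrite /ksub enum_rankK_in ?I0_in. Qed.

Lemma DpolyE : Dpoly p.+1 b omega = D.
Proof. by rewrite /Dpoly TmxE. Qed.

Lemma DtpolyE : Dtpoly p.+1 b omega = Dt.
Proof. by rewrite /Dtpoly TtmxE. Qed.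

Lemma DzE : Dz p.+1 b omega = subst_z D.
Proof. by rewrite /Dz TmxE subst_z_rchar det_map_mx. Qed.

Lemma DtuzE : Dtuz p.+1 b omega = subst_uz Dt.
Proof. by rewrite /Dtuz TtmxE subst_uz_rchar det_map_mx. Qed.

(** The coefficient of [(uz)^i z^j] in the numerator, where the contributions of [Tt] and of [T] are
    separated. *)
Definition numer_coef i j : K := (coefmx i Pt *m U *m coefmx j P) i0 j0.

Lemma coef_Ntpoly k :
  (Ntpoly p.+1 b omega)`_k = \sum_(i < k.+1) numer_coef i (k - i) *: 'X^i.
Proof.
rewrite /Ntpoly TmxE TtmxE UmxE subst_z_rchar subst_uz_rchar -!map_mx_adj.
rewrite -/P -/Pt -/i0 -/j0 mxE coef_sum.
under eq_bigr do rewrite coefM.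
rewrite exchange_big; apply: eq_bigr => i _ /=.
rewrite /numer_coef mxE scaler_suml; apply: eq_bigr => y _.
have -> : ((map_mx (@subst_uz K) Pt *m map_mx (@lift2 K) U) i0 y)`_i =
    (coefmx i Pt *m U) i0 y *: 'X^i.
  rewrite mxE [in RHS]mxE coef_sum scaler_suml; apply: eq_bigr => x _.
  rewrite [map_mx (@subst_uz K) _ _ _]mxE [map_mx (@lift2 K) _ _ _]mxE [coefmx _ _ _ _]mxE.
  by rewrite coefMC coef_subst_uz mulrC mul_polyC scalerA mulrC.
rewrite [map_mx (@subst_z K) _ _ _]mxE [coefmx _ P _ _]mxE coef_subst_z.
by rewrite mulrC mul_polyC scalerA mulrC.
Qed.

Lemma genfun_identity k :
  (forall s : int, ~~ (- b%:Z <= s <= p.+1%:Z) -> beta omega s = 0) ->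
  \sum_(i < k.+1) Grow omega i * (Dtuz p.+1 b omega * Dz p.+1 b omega)`_(k - i)
  = (Ntpoly p.+1 b omega)`_k.
Proof.
move=> b0; pose f l m := Fkl omega (l + m) l.
have fE l m : f l m = (Tt ^+ l *m U *m T ^+ m) i0 j0.
  by apply: Fkl_transfer; rewrite ?ksub_i0 ?ksub_j0.
(* The generating function truncated at degree [k] in [uz] and in [z]. *)
pose F : {poly {poly K}} :=
  \sum_(l < k.+1) \sum_(m < k.+1) lift2 (f l m) * (subst_uz 'X^l * subst_z 'X^m).
(* Up to degree [k] the truncation loses nothing: only pairs with [l + m = i] contribute. *)
have FG i : (i < k.+1)%N -> F`_i = Grow omega i.
  move=> ik; rewrite /F /Grow coef_sum (big_ord_widen _ (fun l => Fkl omega i l *: 'X^l) ik).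
  rewrite [RHS]big_mkcond /=; apply: eq_bigr => l _; rewrite coef_sum.
  have coefF m : (lift2 (f l m) * (subst_uz 'X^l * subst_z 'X^m))`_i =
      if i == (l + m)%N then f l m *: 'X^l else 0.
    rewrite subst_uz_Xn subst_z_Xn -mulrA -exprD coefCM coefCM coefXn mul_polyC.
    by case: eqP => _; rewrite ?mulr1 // mulr0 scaler0.
  under eq_bigr do rewrite coefF.
  case: ltnP => li; last by rewrite big1 // => m _; rewrite ltn_eqF // ltn_addr.
  have mk : (i - l < k.+1)%N by rewrite (leq_ltn_trans (leq_subr _ _)).
  rewrite (bigD1 (Ordinal mk)) //= /f subnKC // eqxx big1 ?addr0 // => m neq.
  case: eqP => // E; case/eqP: neq; apply: ord_inj => /=.
  by rewrite E addKn.
rewrite DzE DtuzE coef_Ntpoly.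
transitivity (F * (subst_uz Dt * subst_z D))`_k.
  by rewrite coefM; apply: eq_bigr => i _; rewrite FG.
rewrite /F mulr_suml coef_sum.
(* The common bound [k.+1] turns both sides into sums over the same pairs [l], [m], compared term by
   term. *)
have nE (i : 'I_k.+1) : numer_coef i (k - i) =
    \sum_(l < k.+1) \sum_(m < k.+1) f l m * ('X^l * Dt)`_i * ('X^m * D)`_(k - i).
  rewrite /numer_coef (coef_adj_expand _ (ltn_ord i)).
  rewrite (@coef_adj_expand _ _ T _ k.+1) ?ltnS ?leq_subr //.
  rewrite !mulmx_suml summxE; apply: eq_bigr => l _.
  rewrite mulmx_sumr summxE; apply: eq_bigr => m _.
  by rewrite -!scalemxAl -scalemxAr scalerA [LHS]mxE -fE mulrC mulrA.
under [RHS]eq_bigr do rewrite nE scaler_suml.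
rewrite exchange_big; apply: eq_bigr => l _ /=.
under [RHS]eq_bigr do rewrite scaler_suml.
rewrite exchange_big mulr_suml coef_sum; apply: eq_bigr => m _ /=.
rewrite -mulrA coefCM mul_polyC mulrACA -!rmorphM coefM scaler_sumr.
apply: eq_bigr => i _; rewrite coef_subst_uz coef_subst_z.
by rewrite -scalerAl [_ * _%:P]mulrC mul_polyC !scalerA.
Qed.

(** * Degrees, and the leading coefficient of the numerator *)

Hypotheses (beta_lo : beta omega (- b%:Z) != 0) (beta_hi : beta omega p.+1%:Z != 0).

Let h0 : beta omega (0%N%:Z - b%:Z) != 0.
Proof. by rewrite sub0r. Qed.

Let hn : beta omega (n%:Z - b%:Z) != 0.
Proof. by rewrite PoszD addrK. Qed.

Let ht0 : betat omega (0%N%:Z - b.+1%:Z) != 0.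
Proof.
by rewrite /betat oppr_eq0; have -> : 0%N%:Z - b.+1%:Z + 1 = - b%:Z by lia.
Qed.

Let htn : betat omega (n%:Z - b.+1%:Z) != 0.
Proof.
by rewrite /betat oppr_eq0; have -> : n%:Z - b.+1%:Z + 1 = p.+1%:Z by lia.
Qed.

Let T_unit : T \in unitmx. Proof. exact: transfer_mx_unit h0 hn _. Qed.
Let Tt_unit : Tt \in unitmx. Proof. exact: transfer_mx_unit ht0 htn _. Qed.

Let r := dvec K p (bot_set p b 0).
Let q := (dvec K p.+1 (slide_set p b 0))^T.

Lemma numer_coefE i j :
  numer_coef i j = (r *m coefmx i Pt *m U *m (coefmx j P *m q)) 0 0.
Proof.
have Er : r = delta_mx 0 i0.
  by rewrite -dvec_ksub ksub_i0; congr dvec; apply/setP => x; rewrite !inE.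
have Eq : q = delta_mx j0 0.
  rewrite -trmx_delta -dvec_ksub ksub_j0; congr (dvec _ _ _)^T.
  by apply/setP => x; rewrite !inE addn0 ltn_ord andbT.
rewrite Er Eq -!mulmxA -rowE [RHS]mxE !mulmxA -colE [RHS]mxE.
by [].
Qed.

(** For [i] below [N = #|KS n p|] the coefficient combines the powers of the inverse of [Tt] with
    exponents [1] to [N - i <= p], all of which [U] kills on row [r]. *)
Lemma row_coef_gt i : (#|KS n p| < i + p.+1)%N -> r *m coefmx i Pt *m U = 0.
Proof.
move=> ip; have [Ni|iN] := leqP #|KS n p| i.
  by rewrite (coef_adj_ge Tt_unit) // mulmx0 mul0mx.
rewrite (@coef_adj_inv _ _ _ Tt_unit (#|KS n p| - i)) ?subnKC 1?ltnW //.
rewrite mulmxN mulNmx mulmx_sumr mulmx_suml big1 ?oppr0 // => k _.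
by rewrite -scalemxAr -scalemxAl (bot_pow_U ht0 htn) ?scaler0 //; have := ltn_ord k; lia.
Qed.

(** Only the exponent [p.+1] survives, and its coefficient is minus the leading one of [Dt]. *)
Lemma row_coef_top i : (i + p.+1 = #|KS n p|)%N ->
  r *m coefmx i Pt *m U = - Dt`_#|KS n p| *: (r *m invmx Tt ^+ p.+1 *m U).
Proof.
move=> ip; rewrite (coef_adj_inv Tt_unit ip) mulmxN mulNmx mulmx_sumr mulmx_suml.
rewrite big_ord_recr /= big1 ?add0r => [|k _]; last first.
  by rewrite -scalemxAr -scalemxAl (bot_pow_U ht0 htn) ?scaler0 //=.
by rewrite ip -scalemxAr -scalemxAl scaleNr.
Qed.

(** The same vanishing on the right, where the exponents [1] to [b] are killed. *)
Lemma col_coef_gt j : (#|KS n p.+1| < j + b.+1)%N -> U *m (coefmx j P *m q) = 0.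
Proof.
move=> jb; have [Nj|jN] := leqP #|KS n p.+1| j.
  by rewrite (coef_adj_ge T_unit) // mul0mx mulmx0.
rewrite (@coef_adj_inv _ _ _ T_unit (#|KS n p.+1| - j)) ?subnKC 1?ltnW //.
rewrite mulNmx mulmxN mulmx_suml mulmx_sumr big1 ?oppr0 // => k _.
by rewrite -scalemxAl -scalemxAr (slide_pow_U h0 hn) ?scaler0 //; have := ltn_ord k; lia.
Qed.

Lemma col_coef_top j : (j + b.+1 = #|KS n p.+1|)%N ->
  U *m (coefmx j P *m q) = - D`_#|KS n p.+1| *: (U *m (invmx T ^+ b.+1 *m q)).
Proof.
move=> jb; rewrite (coef_adj_inv T_unit jb) mulNmx mulmxN mulmx_suml mulmx_sumr.
rewrite big_ord_recr /= big1 ?add0r => [|k _]; last first.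
  by rewrite -scalemxAl -scalemxAr (slide_pow_U h0 hn) ?scaler0 //=.
by rewrite jb -scalemxAl -scalemxAr scaleNr.
Qed.

Lemma size_Dpoly : size (Dpoly p.+1 b omega) = #|KS n p.+1|.+1.
Proof. by rewrite DpolyE size_det_rchar. Qed.

Lemma size_Dtpoly : size (Dtpoly p.+1 b omega) = #|KS n p|.+1.
Proof. by rewrite DtpolyE size_det_rchar. Qed.

Lemma card_KS m k : #|KS m k| = 'C(m, k).
Proof. by rewrite card_draws card_ord. Qed.

(** This and its companion for [p.+1] make the natural subtractions in [itop] and [jtop] exact. *)
Lemma card_KSt_ge : (p.+1 <= #|KS n p|)%N.
Proof. by rewrite card_KS -{1}(binSn p) leq_bin2l // leq_addr. Qed.

Lemma card_KS_ge : (b.+1 <= #|KS n p.+1|)%N.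
Proof.
rewrite card_KS -bin_sub ?leq_addr // addKn.
by rewrite -{1}(binSn b) leq_bin2l // addSnnS leq_addl.
Qed.

Let itop := (#|KS n p| - p.+1)%N.
Let jtop := (#|KS n p.+1| - b.+1)%N.

Lemma numer_coef_top : (0 < b)%N -> numer_coef itop jtop != 0.
Proof.
move=> b_gt0.
rewrite numer_coefE row_coef_top ?subnK ?card_KSt_ge // -scalemxAl -mulmxA.
rewrite col_coef_top ?subnK ?card_KS_ge // -scalemxAr scalerA mxE mulmxA.
rewrite !mulf_neq0 ?oppr_eq0 ?det_rchar_lead //.
exact: (extremal_entry h0 hn ht0 htn b_gt0).
Qed.

Lemma numer_coef_gt i j : (itop < i)%N || (jtop < j)%N -> numer_coef i j = 0.
Proof.
have := card_KSt_ge; have := card_KS_ge; rewrite numer_coefE /itop /jtop.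
move=> jb ip /orP[gt|gt].
  by rewrite row_coef_gt ?mul0mx ?mxE //; lia.
by rewrite -mulmxA col_coef_gt ?mulmx0 ?mxE //; lia.
Qed.

(** [numer_coef] vanishes outside the box bounded by [itop] and [jtop], so the antidiagonal through
    the corner meets the box only there. *)
Lemma coef_Ntpoly_top : (Ntpoly p.+1 b omega)`_(itop + jtop) = numer_coef itop jtop *: 'X^itop.
Proof.
have it : (itop < (itop + jtop).+1)%N by rewrite ltnS leq_addr.
rewrite coef_Ntpoly (bigD1 (Ordinal it)) //= addKn big1 ?addr0 // => i neq.
have {}neq : (i : nat) != itop by apply: contraNneq neq => E; apply/eqP/ord_inj.
by rewrite numer_coef_gt ?scale0r //; have := ltn_ord i; lia.
Qed.

Lemma size_Ntpoly : (0 < b)%N -> size (Ntpoly p.+1 b omega) = (itop + jtop).+1.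
Proof.
move=> b_gt0; apply/eqP; rewrite eqn_leq; apply/andP; split.
  apply/leq_sizeP => k kt; rewrite coef_Ntpoly big1 // => i _.
  by rewrite numer_coef_gt ?scale0r //; have := ltn_ord i; lia.
rewrite ltnNge; apply/negP => /leq_sizeP/(_ _ (leqnn _))/eqP.
rewrite coef_Ntpoly_top scaler_eq0 (negPf (numer_coef_top b_gt0)).
by rewrite -size_poly_eq0 size_polyXn.
Qed.

Lemma lead_coef_Ntpoly : (0 < b)%N ->
  lead_coef (Ntpoly p.+1 b omega) = numer_coef itop jtop *: 'X^itop.
Proof. by move=> b_gt0; rewrite lead_coefE size_Ntpoly // coef_Ntpoly_top. Qed.
End Main.

(* Power-series identity in K[u][[z]] stated coefficientwise: since the
   denominator tD(uz) D(z) has constant term 1 in z, the identity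
   G = tN / (tD(uz) D(z)) is equivalent to G * (tD(uz) D(z)) = tN,
   i.e. to the equality of all z^n coefficients (each a polynomial in u). *)
Theorem mainTheorem9 (K : fieldType) (S : seq int) (a b : nat) (omega : int -> K)
  (hchar : [pchar K] =i pred0)
  (ha : (1 <= a)%N) (hb : (1 <= b)%N)
  (haS : a%:Z \in S) (hbS : - b%:Z \in S)
  (hSbd : forall s, s \in S -> - b%:Z <= s <= a%:Z)
  (homegaS : forall s, s \notin S -> omega s = 0)
  (hwa : omega a%:Z != 0) (hwb : omega (- b%:Z) != 0) :
  [/\ (forall n : nat,
         \sum_(k < n.+1) Grow omega k * (Dtuz a b omega * Dz a b omega)`_(n - k)
         = (Ntpoly a b omega)`_n),
      size (Dpoly a b omega) = ('C(a + b, a)).+1,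
      size (Dtpoly a b omega) = ('C(a + b, a.-1)).+1,
      size (Ntpoly a b omega) = ('C(a + b + 1, a) - a - b - 1).+1
    & exists2 c : K, c != 0 &
        lead_coef (Ntpoly a b omega) = c *: 'X^('C(a + b, a.-1) - a)].
Proof.
case: a ha haS hSbd hwa => // p _ haS' hSbd' hwa'.
have bE s : s != 0 -> beta omega s = - omega s.
  by move=> s0; rewrite /beta (negPf s0) sub0r.
(* The interval contains [0], so outside it the Kronecker delta vanishes together with [omega]. *)
have b0 s : ~~ (- b%:Z <= s <= p.+1%:Z) -> beta omega s = 0.
  move=> sb; rewrite bE ?homegaS ?oppr0 //; first by apply: contra sb; apply: hSbd'.
  by apply: contraNneq sb => ->; lia.
have blo : beta omega (- b%:Z) != 0 by rewrite bE ?oppr_eq0 //; lia.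
have bhi : beta omega p.+1%:Z != 0 by rewrite bE ?oppr_eq0.
have Nt := card_KSt_ge p b; have N := card_KS_ge p b.
split.
- by move=> k; apply: genfun_identity.
- by rewrite (size_Dpoly blo bhi) card_KS.
- by rewrite (size_Dtpoly blo bhi) card_KS.
(* Pascal's rule joins the two binomials; [Nt] and [N] keep the natural subtractions exact. *)
- rewrite (size_Ntpoly blo bhi hb) !card_KS [(p.+1 + b + 1)%N]addn1 binS; congr _.+1.
  by rewrite !card_KS in Nt N *; lia.
exists (@numer_coef K p b omega (#|KS (p.+1 + b) p| - p.+1) (#|KS (p.+1 + b) p.+1| - b.+1)).
  exact: (numer_coef_top blo bhi hb).
by rewrite (lead_coef_Ntpoly blo bhi hb) card_KS.
Qed.
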